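(* Let $r\ge1$, $n=2r$, and let $\lambda=(n-j,1^j)$ be a hook partition of $n$, $0\le j\le n-1$. Then $$g_{(r,r)\lambda}=\begin{cases}0 & \text{if } j<r,\\ (-1)^{r+j} & \text{if } j\ge r.\end{cases}$$
   Context: For a partition $\mu$, $P_\mu(x;t)$ denotes the Hall–Littlewood $P$-function, which is well defined at $t=-1$ for every partition $\mu$. For partitions $\mu,\lambda$ the integers $g_{\mu\lambda}$ are defined by the expansion $P_\mu(x;-1)=\sum_\lambda g_{\mu\lambda}s_\lambda(x)$ in Schur functions $s_\lambda$. Here $(r,r)$ is the partition with two parts equal to $r$. *)

(* Defs.v *)
From HB Require Import structures.
From mathcomp Require Import all_boot all_order all_fingroup all_algebra.
From mathcomp Require Import fraction finmap mpoly.
From Stdlib Require Import ClassicalEpsilon.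

Set Implicit Arguments.
Unset Strict Implicit.
Unset Printing Implicit Defensive.

Import GRing.Theory.

Local Open Scope ring_scope.

Notation "x %:F" := (@FracField.tofrac _ x) : ring_scope.

(* Partitions are weakly decreasing sequences of positive integers; the
   (i+1)-st part of la, extended by zeros, is nth 0 la i. *)
Definition is_part (la : seq nat) : bool := sorted geq la && (0%N \notin la).

Section HallLittlewood.

Variables (N : nat) (la : seq nat).

Local Notation K := {fraction {mpoly {poly int}[N]}}.

Definition HLt : K := (('X : {poly int})%:MP_[N])%:F.
Definition HLx (i : 'I_N) : K := ('X_i : {mpoly {poly int}[N]})%:F.

Definition HL_v (m : nat) : K :=
  \prod_(1 <= i < m.+1) ((1 - HLt ^+ i) / (1 - HLt)).

(* Multiplicity of the part i in (la_1, ..., la_N), zeros included. *)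
Definition HL_mult (i : nat) : nat := #|[set k : 'I_N | nth 0%N la k == i]|.

Definition HL_vpart : K := \prod_(0 <= i < (head 0%N la).+1) HL_v (HL_mult i).

Definition HL_R : K :=
  \sum_(w : 'S_N)
    (\prod_(i < N) HLx (w i) ^+ nth 0%N la i) *
    \prod_(i < N) \prod_(j < N | (i < j)%N)
      ((HLx (w i) - HLt * HLx (w j)) / (HLx (w i) - HLx (w j))).

(* P_la(x_1, ..., x_N; t) for generic t, zero when la has more than N parts. *)
Definition HL_P : K := if (size la <= N)%N then HL_R / HL_vpart else 0.

(* q = P_la(x_1, ..., x_N; a): the generic P_la must have coefficients in
   Z[t], and these are evaluated at t = a.  Substituting t = a in the quotient
   HL_R / HL_vpart is not possible in general: HL_vpart vanishes at t = -1 as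
   soon as some multiplicity is at least 2. *)
Definition HL_P_at (a : int) (q : {mpoly int[N]}) : Prop :=
  exists2 p : {mpoly {poly int}[N]},
    p%:F = HL_P & q = map_mpoly (horner_eval a) p.

End HallLittlewood.

Section Schur.

Variables (N : nat) (la : seq nat).

Local Notation K := {fraction {mpoly int[N]}}.

Definition schur_x (i : 'I_N) : K := ('X_i : {mpoly int[N]})%:F.

(* N - j.+1 is N - 1 - j, the j-th entry of delta = (N-1, ..., 1, 0). *)
Definition schur : K :=
  if (size la <= N)%N then
    \det (\matrix_(i < N, j < N) schur_x i ^+ (nth 0%N la j + (N - j.+1))) /
    \det (\matrix_(i < N, j < N) schur_x i ^+ (N - j.+1))
  else 0.

End Schur.

(* P_mu(x; -1) = \sum_la c_la s_la(x) in the ring of symmetric functions in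
   infinitely many variables, the inverse limit of the rings of symmetric
   polynomials in N variables: the identity is required for every N, with the
   same coefficients c. *)
Definition is_schur_expansion (mu : seq nat)
    (c : {fsfun seq nat -> int with 0}) : Prop :=
  (forall la, la \in finsupp c -> is_part la) /\
  (forall N : nat, exists2 q : {mpoly int[N]},
     HL_P_at mu (-1) q &
     q%:F = \sum_(la <- finsupp c) schur N la *~ c la).

(* The coefficients g_{mu, la}: the expansion is unique, the Schur functions
   being linearly independent, so epsilon picks the only candidate. *)
Definition g (mu la : seq nat) : int :=
  epsilon (inhabits ([fsfun] : {fsfun seq nat -> int with 0}))
    (is_schur_expansion mu) la.

(* Main.v *)
(* Write V = det (x_i^(N-j)) and let a_al = det (x_i^al_j), so that
   s_la = a_(la+delta) / V.  Scaling x_a by 1/t multiplies V by a constant times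
   \prod_(k != a) (x_a - t x_k) / (x_a - x_k), while in the Leibniz expansion of V
   it multiplies each monomial by a power of t.  Comparing the two evaluates the
   sum over S_N defining the Hall-Littlewood polynomial one variable at a time:
   the variables beyond the first two contribute the normalising factor, and
   the first two give
     V P_(r,r)(x; t) = \sum_(c < d) t^(c+d-1) a_(delta + r e_c + r e_d),
   with c, d counted from 0.  At t = -1 most of these alternants have two equal
   exponents.  Those with d < r sort to partitions (r-c, r-d+1, 2^c, 1^(d-c-1)),
   never hooks, and those with d = c + r sort to the hooks (2r-d, 1^d) with
   coefficient (-1)^c.  Uniqueness of the expansion follows by reading off the
   coefficient of x^(la+delta). *)

Require Import Defs.
From mathcomp Require Import all_boot all_order all_algebra.
From mathcomp Require Import all_fingroup fraction finmap mpoly ring zify.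
From Stdlib Require Import ClassicalEpsilon.

Set Implicit Arguments.
Unset Strict Implicit.
Unset Printing Implicit Defensive.

Import GRing.Theory.

Local Open Scope ring_scope.

(** * Alternants *)

Definition alternant (R : comNzRingType) n (y : 'I_n -> R) (al : 'I_n -> nat) : R :=
  \det (\matrix_(i, j) y i ^+ al j).

Definition delta n (j : 'I_n) : nat := (n - j.+1)%N.

Section Alternants.

Variable R : comNzRingType.

Lemma eq_alternant n (y y' : 'I_n -> R) al al' :
  y =1 y' -> al =1 al' -> alternant y al = alternant y' al'.
Proof.
by move=> ey ea; congr (\det _); apply/matrixP=> i j; rewrite !mxE ey ea.
Qed.

Lemma alternantE n (y : 'I_n -> R) al :
  alternant y al = \sum_(w : 'S_n) (-1) ^+ w * \prod_i y i ^+ al (w i).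
Proof.
by apply: eq_bigr => w _; congr (_ * _); apply: eq_bigr => i _; rewrite mxE.
Qed.

Lemma alternant_permr n (y : 'I_n -> R) al (s : 'S_n) :
  alternant y al = (-1) ^+ s * alternant y (al \o s).
Proof.
have -> : alternant y (al \o s) = \det (col_perm s (\matrix_(i, j) y i ^+ al j)).
  by congr (\det _); apply/matrixP=> i j; rewrite !mxE.
by rewrite col_permE det_mulmx det_perm mulrC odd_permV -mulrA -expr2 sqrr_sign mulr1.
Qed.

Lemma alternant_perml n (y : 'I_n -> R) al (s : 'S_n) :
  alternant y al = (-1) ^+ s * alternant (y \o s) al.
Proof.
have -> : alternant (y \o s) al = \det (row_perm s (\matrix_(i, j) y i ^+ al j)).
  by congr (\det _); apply/matrixP=> i j; rewrite !mxE.
by rewrite row_permE det_mulmx det_perm mulrA -expr2 sqrr_sign mul1r.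
Qed.

Lemma alternant_collision n (y : 'I_n -> R) al c d :
  c != d -> al c = al d -> alternant y al = 0.
Proof.
move=> ncd e; rewrite /alternant -det_tr; apply: (determinant_alternate ncd) => i.
by rewrite !mxE e.
Qed.

(** The sign [s] comes from reversing the columns of the Vandermonde matrix. It is chosen before
    [y], so it cancels whenever two families of variables are compared. *)
Lemma alternant_delta n :
  exists s : 'S_n, forall y : 'I_n -> R, alternant y (@delta n) =
    (-1) ^+ s * \prod_(i < n) \prod_(j < n | (i < j)%N) (y j - y i).
Proof.
exists (perm rev_ord_inj) => y.
rewrite (alternant_permr _ _ (perm rev_ord_inj)); congr (_ * _).
transitivity (\det (Vandermonde n (\row_j y j))).
  rewrite -det_tr; congr (\det _); apply/matrixP=> i j; rewrite !mxE /= permE.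
  by congr (_ ^+ _); rewrite /delta /=; have := ltn_ord j; lia.
rewrite det_Vandermonde.
by do 2!(apply: eq_bigr => ? _); rewrite !mxE.
Qed.

End Alternants.

(** Moving row [a] to the front isolates the factors that involve [y a]. The constant [e] collects
    signs that do not depend on [y]. *)
Lemma alternant_delta_lift (R : comNzRingType) n (a : 'I_n.+1) :
  exists e : R, forall y : 'I_n.+1 -> R,
    alternant y (@delta n.+1) =
      e * (\prod_(i < n) \prod_(j < n | (i < j)%N) (y (lift a j) - y (lift a i)))
        * \prod_k (y (lift a k) - y a).
Proof.
have [s hs] := alternant_delta R n.+1.
set u := lift_perm ord0 a 1%g.
exists ((-1) ^+ u * (-1) ^+ s) => y.
rewrite (alternant_perml _ _ u) hs -!mulrA; congr (_ * (_ * _)).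
rewrite big_ord_recl mulrC; congr (_ * _).
  apply: eq_bigr => i _; rewrite big_mkcond big_ord_recl /= mul1r.
  rewrite [RHS]big_mkcond /=; apply: eq_bigr => j _.
  by rewrite /u /= !lift_perm_lift !perm1 /bump /= !add1n ltnS.
rewrite big_mkcond big_ord_recl /= mul1r; apply: eq_bigr => j _.
by rewrite /u /= lift_perm_lift lift_perm_id perm1.
Qed.

(** The effect on the Vandermonde determinant of changing one variable, cross-multiplied so that no
    division occurs. *)
Lemma alternant_replace (R : comNzRingType) n (y y' : 'I_n.+1 -> R) (a : 'I_n.+1) :
  (forall k, y' (lift a k) = y (lift a k)) ->
  alternant y' (@delta _) * \prod_k (y a - y (lift a k)) =
  alternant y (@delta _) * \prod_k (y' a - y (lift a k)).
Proof.
move=> eyy'; have [e h] := alternant_delta_lift R a.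
have sgn z : \prod_k (z - y (lift a k)) = (-1) ^+ n * \prod_k (y (lift a k) - z).
  rewrite -[n in _ ^+ n]card_ord -prodr_const -big_split /=.
  by apply: eq_bigr => k _; ring.
rewrite !h !sgn.
have -> : \prod_(i < n) \prod_(j < n | (i < j)%N) (y' (lift a j) - y' (lift a i))
    = \prod_(i < n) \prod_(j < n | (i < j)%N) (y (lift a j) - y (lift a i)).
  by do 2!(apply: eq_bigr => ? _); rewrite !eyy'.
have -> : \prod_k (y' (lift a k) - y' a) = \prod_k (y (lift a k) - y' a).
  by apply: eq_bigr => k _; rewrite eyy'.
ring.
Qed.

(* Modulo the monic polynomial \prod_i ('X - y_i) every power of 'X becomes a
   combination of 1, ..., 'X^(n-1), so the matrix (y_i ^ al_j) is the
   Vandermonde matrix times a matrix with entries in R. *)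
Lemma alternant_dvd (R : comNzRingType) n (y : 'I_n -> R) al :
  exists S, alternant y al = alternant y (@delta n) * S.
Proof.
pose P := \prod_(i < n) ('X - (y i)%:P).
have Pm : P \is monic by apply: monic_prod_XsubC.
pose C := \matrix_(k < n, j < n) (Pdiv.Ring.rmodp 'X^(al j) P)`_(n - k.+1).
exists (\det C); rewrite /alternant -det_mulmx; congr (\det _).
apply/matrixP => i j; rewrite !mxE.
have := congr1 (horner^~ (y i)) (Pdiv.RingMonic.rdivp_eq Pm 'X^(al j)).
rewrite hornerXn hornerD hornerM.
have -> : P.[y i] = 0.
  by rewrite /P horner_prod (bigD1 i) //= hornerXsubC subrr mul0r.
rewrite mulr0 add0r => ->.
rewrite (@horner_coef_wide _ n); last first.
  have := Pdiv.Ring.ltn_rmodpN0 'X^(al j) (monic_neq0 Pm).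
  by rewrite {2}/P -big_enum size_prod_XsubC size_enum_ord ltnS.
rewrite (reindex_inj rev_ord_inj) /=; apply: eq_bigr => k _.
by rewrite !mxE /delta mulrC.
Qed.

Lemma map_alternant (R S : comNzRingType) (f : {rmorphism R -> S}) n
    (y : 'I_n -> R) al :
  f (alternant y al) = alternant (f \o y) al.
Proof.
rewrite /alternant -det_map_mx; congr (\det _).
by apply/matrixP=> i j; rewrite !mxE rmorphXn.
Qed.

Lemma big_lift (R : Type) (idx : R) (op : Monoid.com_law idx) n (a : 'I_n.+1)
    (P : pred 'I_n.+1) (F : 'I_n.+1 -> R) :
  \big[op/idx]_(k | (k != a) && P k) F k =
  \big[op/idx]_(k < n | P (lift a k)) F (lift a k).
Proof.
rewrite (reindex_omap (lift a) (unlift a)) => [|k /andP[nka _]] /=.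
  by apply: eq_bigl => k; rewrite liftK eqxx andbT eq_sym neq_lift.
by case: unliftP nka => [k' ->|->] //; rewrite eqxx.
Qed.

Lemma sum_neq_sym (R : nmodType) n (F : 'I_n -> 'I_n -> R) :
  (forall a b, F a b = F b a) ->
  \sum_a \sum_(b | b != a) F a b = (\sum_(a < n) \sum_(b < n | (a < b)%N) F a b) *+ 2.
Proof.
move=> Fs; rewrite mulr2n.
have -> : \sum_a \sum_(b | b != a) F a b =
    \sum_(a < n) \sum_(b < n | (a < b)%N) F a b + \sum_(a < n) \sum_(b < n | (b < a)%N) F a b.
  rewrite -big_split /=; apply: eq_bigr => a _.
  rewrite (bigID (fun b : 'I_n => (a < b)%N)) /=.
  by congr (_ + _); apply: eq_bigl => b; rewrite -val_eqE /=; lia.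
congr (_ + _); rewrite (exchange_big_dep xpredT) //=.
by do 2!(apply: eq_bigr => ? _); rewrite Fs.
Qed.

Lemma prod_exp_indicator (R : comNzRingType) n (F : 'I_n -> R) (a : 'I_n) r :
  \prod_i F i ^+ ((i == a) * r) = F a ^+ r.
Proof.
rewrite (bigD1 a) //= eqxx mul1n big1 ?mulr1 // => i /negbTE ->.
by rewrite mul0n expr0.
Qed.

(** * Scaling one or two variables of an alternant *)

Section Scaling.

Variables (R : comNzRingType) (n : nat) (u : R) (y : 'I_n -> R) (al : 'I_n -> nat).

Definition scale_at (a i : 'I_n) : R := if i == a then u * y i else y i.

Definition scale_at2 (a b i : 'I_n) : R :=
  if (i == a) || (i == b) then u * y i else y i.

(** Scaling variable [a] multiplies the Leibniz term of [w] by u^(al (w a)). As [a] varies, [w a]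
    runs through all columns, so the sum of these powers is the same for every [w]. *)
Lemma sum_alternant_scale :
  \sum_a alternant (scale_at a) al = (\sum_c u ^+ al c) * alternant y al.
Proof.
under eq_bigr do rewrite alternantE.
rewrite exchange_big alternantE mulr_sumr /=; apply: eq_bigr => w _.
rewrite [in RHS](reindex_inj (@perm_inj _ w)) /= mulr_suml; apply: eq_bigr => a _.
rewrite mulrCA; congr (_ * _).
(* The single power of [u] is spread over all rows, with exponent zero away from [a], so that the
   products agree factor by factor. *)
rewrite -[u ^+ _](prod_exp_indicator (fun=> u) a) -big_split /=.
apply: eq_bigr => i _; rewrite /scale_at; case: (eqVneq i a) => [->|_].
  by rewrite mul1n exprMn.
by rewrite mul0n mul1r.
Qed.

Definition add2 r (c d j : 'I_n) : nat := (al j + (j == c) * r + (j == d) * r)%N.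

Lemma add2C r c d : add2 r c d =1 add2 r d c.
Proof. by move=> j; rewrite /add2 addnAC. Qed.

(** As for one variable, with (c, d) = (w a, w b) in each Leibniz term; the factor (y_a y_b)^r
    raises the exponents of columns [c] and [d] by [r]. *)
Lemma sum_alternant_scale2 r :
  \sum_a \sum_(b | b != a) (y a * y b) ^+ r * alternant (scale_at2 a b) al =
  \sum_c \sum_(d | d != c) u ^+ (al c + al d) * alternant y (add2 r c d).
Proof.
under eq_bigr do under eq_bigr do rewrite alternantE mulr_sumr.
under [RHS]eq_bigr do under eq_bigr do rewrite alternantE mulr_sumr.
under eq_bigr do rewrite exchange_big.
under [RHS]eq_bigr do rewrite exchange_big.
rewrite exchange_big [RHS]exchange_big /=; apply: eq_bigr => w _.
rewrite [RHS](reindex_inj (@perm_inj _ w)) /=; apply: eq_bigr => a _.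
rewrite [RHS](reindex_inj (@perm_inj _ w)) /=.
apply: eq_big => [b|b nba]; first by rewrite (inj_eq (@perm_inj _ w)).
rewrite mulrCA [RHS]mulrCA; congr (_ * _).
rewrite exprD exprMn.
rewrite -(prod_exp_indicator y a r) -(prod_exp_indicator y b r).
rewrite -[u ^+ al (w a)](prod_exp_indicator (fun=> u) a).
rewrite -[u ^+ al (w b)](prod_exp_indicator (fun=> u) b) -!big_split /=.
apply: eq_bigr => i _; rewrite /scale_at2 /add2 !(inj_eq (@perm_inj _ w)).
case: (eqVneq i a) => [->|_]; case: (eqVneq _ b) => [e|_] //=.
- by rewrite e eqxx in nba.
- by rewrite !mul1n !mul0n addn0 exprD exprMn; ring.
- by rewrite e !mul1n !mul0n addn0 exprD exprMn; ring.
- by rewrite !mul0n !addn0; ring.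
Qed.

End Scaling.

(** * Hall-Littlewood polynomials *)

Section HallLittlewoodSums.

Variables (K : fieldType) (t : K).

Definition rho (u v : K) : K := (u - t * v) / (u - v).

(** The family [y] is arbitrary, so that removing a variable leaves a sum of the same shape. *)
Definition HLsum (la : seq nat) n (y : 'I_n -> K) : K :=
  \sum_(w : 'S_n) (\prod_(i < n) y (w i) ^+ nth 0%N la i) *
    \prod_(i < n) \prod_(j < n | (i < j)%N) rho (y (w i)) (y (w j)).

(** A permutation is determined by the image of 0 and what remains; injectivity and the count (n+1)!
    = (n+1) n! give the bijection. *)
Lemma sum_lift_perm n (F : 'S_n.+1 -> K) :
  \sum_w F w = \sum_a \sum_(u : 'S_n) F (lift_perm ord0 a u).
Proof.
rewrite pair_big /=.
have inj : injective (fun p : 'I_n.+1 * 'S_n => lift_perm ord0 p.1 p.2).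
  move=> [a u] [b v] /= e.
  have eab : a = b by rewrite -(lift_perm_id ord0 a u) e lift_perm_id.
  rewrite -eab in e *; congr (_, _); apply/permP => k.
  by apply: (@lift_inj _ a); rewrite -!(lift_perm_lift ord0) e.
have bij := inj_card_bij inj.
rewrite (reindex (fun p : 'I_n.+1 * 'S_n => lift_perm ord0 p.1 p.2)) //.
by apply: onW_bij; apply: bij; rewrite card_prod !card_Sn card_ord factS.
Qed.

Lemma HLsum_lift la n (y : 'I_n.+1 -> K) :
  HLsum la y = \sum_a y a ^+ head 0%N la * \prod_k rho (y a) (y (lift a k)) *
    HLsum (behead la) (fun k => y (lift a k)).
Proof.
rewrite /HLsum sum_lift_perm; apply: eq_bigr => a _.
rewrite mulr_sumr; apply: eq_bigr => u _.
rewrite !big_ord_recl /= lift_perm_id nth0 -!mulrA; congr (_ * _).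
rewrite mulrCA; congr (_ * _).
  rewrite big_mkcond big_ord_recl /= mul1r [RHS](reindex_inj (@perm_inj _ u)) /=.
  by apply: eq_bigr => k _; rewrite lift_perm_lift.
congr (_ * _); apply: eq_bigr => i _.
  by rewrite lift_perm_lift nth_behead.
rewrite big_mkcond big_ord_recl /= mul1r [RHS]big_mkcond /=.
by apply: eq_bigr => j _; rewrite !lift_perm_lift /bump /= !add1n ltnS.
Qed.

Lemma alternant_delta_neq0 n (y : 'I_n -> K) :
  injective y -> alternant y (@delta n) != 0.
Proof.
move=> yi; have [s ->] := alternant_delta K n.
rewrite mulf_neq0 ?signr_eq0 //; apply/prodf_neq0 => i _.
apply/prodf_neq0 => j ij; rewrite subr_eq0; apply/negP => /eqP /yi e.
by rewrite e ltnn in ij.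
Qed.

Hypothesis t0 : t != 0.

(** Each of the [n] factors becomes t^-1 y_a - y_k = t^-1 (y_a - t y_k), the numerator of [rho] up
    to t^-1. *)
Lemma alternant_scale_rho n (y : 'I_n.+1 -> K) a :
  (forall k, y a != y (lift a k)) ->
  alternant (scale_at t^-1 y a) (@delta _) =
    t ^- n * alternant y (@delta _) * \prod_k rho (y a) (y (lift a k)).
Proof.
move=> ya.
have p0 : \prod_k (y a - y (lift a k)) != 0.
  by apply/prodf_neq0 => k _; rewrite subr_eq0.
apply: (mulIf p0); rewrite alternant_replace; last first.
  by move=> k; rewrite /scale_at eq_sym (negbTE (neq_lift _ _)).
rewrite -[RHS]mulrA -big_split /= -mulrA [RHS]mulrCA; congr (_ * _).
rewrite -exprVn -[n in _ ^+ n]card_ord -prodr_const -big_split /=.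
apply: eq_bigr => k _; rewrite /rho /scale_at eqxx divfK ?subr_eq0 //.
by rewrite mulrBr mulrA mulVf // mul1r.
Qed.

(** Multiplied by the Vandermonde alternant, the left side is t^n times the sum of the scaled
    alternants, which [sum_alternant_scale] evaluates; t^n t^-(n-c) = t^c. *)
Lemma sum_prod_rho n (y : 'I_n.+1 -> K) : injective y ->
  \sum_a \prod_k rho (y a) (y (lift a k)) = \sum_(c < n.+1) t ^+ c.
Proof.
move=> yi; apply: (mulfI (alternant_delta_neq0 yi)).
rewrite mulr_sumr.
transitivity (\sum_a t ^+ n * alternant (scale_at t^-1 y a) (@delta _)).
  apply: eq_bigr => a _; rewrite alternant_scale_rho => [|k].
    by rewrite !mulrA mulfV ?mul1r // expf_neq0.
  by rewrite (inj_eq yi) neq_lift.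
rewrite -mulr_sumr sum_alternant_scale mulrA mulrC; congr (_ * _).
rewrite mulr_sumr; apply: eq_bigr => c _.
have cn : (c <= n)%N by rewrite -ltnS.
by rewrite /delta subSS exprVn -expfB_cond ?subKn ?(negbTE t0) //= ?add0n ?leq_subr.
Qed.

(** The value of [sum_prod_rho] does not depend on the variables, so they can be removed one at a
    time. The product is the normalising factor for [n] equal parts. *)
Lemma HLsum_nil n (y : 'I_n -> K) : injective y ->
  HLsum [::] y = \prod_(m < n) \sum_(c < m.+1) t ^+ c.
Proof.
elim: n y => [|n IH] y yi.
  rewrite /HLsum (big_pred1 1%g) ?big_ord0 ?mulr1 // => w.
  by apply/esym/eqP/permP => -[].
rewrite HLsum_lift [RHS]big_ord_recr /= [RHS]mulrC -(sum_prod_rho yi) mulr_suml.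
apply: eq_bigr => a _; rewrite mul1r IH // => i j /yi; exact: lift_inj.
Qed.

(** Scale [a], then [b]. Each step costs t^-(n+1), and the second meets the already scaled [y a],
    whose factor is rho(y_b, t^-1 y_a) = t / rho(y_a, y_b). The hypothesis [y a != t * y b] keeps
    the variables [a] and [b] distinct after the first step. *)
Lemma alternant_scale2_rho n (y : 'I_n.+2 -> K) a b :
  injective y -> b != a -> y a != t * y b ->
  alternant (scale_at2 t^-1 y a b) (@delta _) * rho (y a) (y b) * t ^+ n.*2.+1 =
  alternant y (@delta _) * \prod_(k | k != a) rho (y a) (y k) *
    \prod_(k | (k != a) && (k != b)) rho (y b) (y k).
Proof.
move=> yi nba h2.
have h1 : y b != t^-1 * y a.
  by apply: contraNneq h2 => ->; rewrite mulrA mulfV ?mul1r.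
set y1 := scale_at t^-1 y a.
have -> : alternant (scale_at2 t^-1 y a b) (@delta _) =
    alternant (scale_at t^-1 y1 b) (@delta _).
  apply: eq_alternant => // i; rewrite /y1 /scale_at2 /scale_at.
  case: (eqVneq i b) => [->|_]; last by rewrite orbF.
  by rewrite (negbTE nba).
have y1b : y1 b = y b by rewrite /y1 /scale_at (negbTE nba).
have y1a : y1 a = t^-1 * y a by rewrite /y1 /scale_at eqxx.
have y1k k : k != a -> y1 k = y k by move=> h; rewrite /y1 /scale_at (negbTE h).
rewrite alternant_scale_rho => [|k]; last first.
  rewrite y1b; have [->|nka] := eqVneq (lift b k) a; first by rewrite y1a.
  by rewrite y1k // (inj_eq yi) neq_lift.
rewrite alternant_scale_rho => [|k]; last by rewrite (inj_eq yi) neq_lift.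
rewrite -(big_lift _ _ xpredT (fun k => rho (y a) (y k))).
rewrite -(big_lift _ b xpredT (fun k => rho (y1 b) (y1 k))).
rewrite (bigD1 (P := fun k => (k != b) && true) a) /=; last by rewrite andbT eq_sym.
have -> : \prod_(k | (k != a) && (k != b)) rho (y b) (y k) =
    \prod_(k | (k != b) && true && (k != a)) rho (y1 b) (y1 k).
  apply: eq_big => [k|k /andP[nka _]]; first by rewrite andbT andbC.
  by rewrite y1b y1k.
rewrite [\prod_(k | k != a) _](eq_bigl (fun k => (k != a) && true)); last first.
  by move=> k; rewrite andbT.
have er : rho (y1 b) (y1 a) = t / rho (y a) (y b).
  rewrite y1b y1a /rho; field.
  by rewrite (mulrC (y b) t) t0 !subr_eq0 (inj_eq yi) eq_sym nba h2 eq_sym h2.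
have r0 : rho (y a) (y b) != 0.
  by rewrite mulf_neq0 ?invr_eq0 ?subr_eq0 // (inj_eq yi) eq_sym.
rewrite er.
have -> : t ^+ n.*2.+1 = t ^+ n.+1 * t ^+ n.+1 / t.
  by rewrite -exprD addSn addnS addnn [in RHS]exprSr mulfK.
field.
by rewrite t0 r0 expf_neq0.
Qed.

(** The sums run over ordered pairs, and doubling the left side lets the terms of (a, b) and (b, a)
    be added. *)
Lemma HLsum_rr n (y : 'I_n.+2 -> K) r :
  injective y -> (forall a b, b != a -> y a != t * y b) ->
  alternant y (@delta _) * HLsum [:: r; r] y *+ 2 =
  \prod_(m < n) (\sum_(c < m.+1) t ^+ c) * (1 + t) *
    \sum_(c < n.+2) \sum_(d < n.+2 | d != c)
      t ^+ (c + d).-1 * alternant y (add2 (@delta n.+2) r c d).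
Proof.
move=> yi yt.
pose E a b := \prod_(k | k != a) rho (y a) (y k) *
  \prod_(k | (k != a) && (k != b)) rho (y b) (y k).
(* Peel off the two variables that carry the exponent [r]; the others form an [HLsum] of the empty
   partition. *)
have -> : HLsum [:: r; r] y = \prod_(m < n) (\sum_(c < m.+1) t ^+ c) *
    \sum_a \sum_(b | b != a) (y a * y b) ^+ r * E a b.
  rewrite HLsum_lift mulr_sumr; apply: eq_bigr => a _ /=.
  rewrite HLsum_lift [\sum_(b | b != a) _](eq_bigl (fun b => (b != a) && true)).
    rewrite big_lift !mulr_sumr; apply: eq_bigr => b _ /=.
    rewrite HLsum_nil => [|i j /yi /lift_inj /lift_inj //].
    rewrite /E big_lift.
    rewrite [\prod_(k | k != a) _](eq_bigl (fun k => (k != a) && true)).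
      rewrite big_lift exprMn.
      rewrite [\prod_(k < n.+1 | _) rho (y (lift a b)) _](eq_bigl (fun k => (k != b) && true)).
        by rewrite big_lift; ring.
      by move=> k; rewrite andbT (inj_eq lift_inj).
    by move=> k; rewrite andbT.
  by move=> k; rewrite andbT.
rewrite -!mulrnAr mulrCA -[RHS]mulrA; congr (_ * _).
pose V2 a b := alternant (scale_at2 t^-1 y a b) (@delta _).
have V2C a b : V2 a b = V2 b a.
  by apply: eq_alternant => // i; rewrite /scale_at2 orbC.
have VE a b : b != a -> alternant y (@delta _) * E a b =
    t ^+ n.*2.+1 * (rho (y a) (y b) * V2 a b).
  move=> nba; have := alternant_scale2_rho yi nba (yt _ _ nba).
  by rewrite -/(V2 a b) -[RHS]mulrA -/(E a b) => <-; ring.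
(* Symmetrise in (a, b): [V2] is symmetric and rho(u, v) + rho(v, u) = 1 + t. *)
have -> : alternant y (@delta _) *
    ((\sum_a \sum_(b | b != a) (y a * y b) ^+ r * E a b) *+ 2) =
    t ^+ n.*2.+1 * (1 + t) *
    \sum_a \sum_(b | b != a) (y a * y b) ^+ r * V2 a b.
  transitivity (t ^+ n.*2.+1 *
      ((\sum_a \sum_(b | b != a) (y a * y b) ^+ r * (rho (y a) (y b) * V2 a b)) *+ 2)).
    rewrite !mulrnAr !mulr_sumr; congr (_ *+ 2).
    apply: eq_bigr => a _; rewrite !mulr_sumr; apply: eq_bigr => b nba.
    by rewrite mulrCA VE // [RHS]mulrCA.
  rewrite -[RHS]mulrA; congr (_ * _); rewrite mulr2n.
  rewrite [X in _ + X](exchange_big_dep xpredT) //= -big_split /= mulr_sumr.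
  apply: eq_bigr => a _; rewrite [X in _ + X](eq_bigl (fun b => b != a)).
    rewrite -big_split /= mulr_sumr; apply: eq_bigr => b nba.
    rewrite (mulrC (y b)) (V2C b) -mulrDr -mulrDl mulrCA; congr (_ * (_ * _)).
    have nab : y a - y b != 0 by rewrite subr_eq0 (inj_eq yi) eq_sym.
    rewrite /rho; field; rewrite nab -opprB oppr_eq0 nab //.
  by move=> b; rewrite eq_sym.
rewrite -mulrA mulrCA sum_alternant_scale2; congr (_ * _).
rewrite mulr_sumr; apply: eq_bigr => c _; rewrite mulr_sumr; apply: eq_bigr => d ndc.
rewrite mulrA; congr (_ * _).
have hd : (delta c + delta d + (c + d).-1 = n.*2.+1)%N.
  have := ltn_ord c; have := ltn_ord d; move: ndc; rewrite -val_eqE /= /delta; lia.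
by rewrite -hd exprD exprVn mulrAC mulfV ?mul1r // expf_neq0.
Qed.

End HallLittlewoodSums.

Lemma HL_R_HLsum N la : HL_R N la = HLsum (HLt N) la (@HLx N).
Proof. by []. Qed.

(** * The generic function P_(r,r) and its value at t = -1 *)

Section Generic.

Variable N : nat.
Local Notation t := (HLt N).
Local Notation x := (@HLx N).

Lemma HLtX k : t ^+ k = (('X^k : {poly int})%:MP_[N])%:F.
Proof. by rewrite /HLt -!rmorphXn. Qed.

Lemma HLt_sum_neq0 m : \sum_(c < m.+1) t ^+ c != 0.
Proof.
under eq_bigr do rewrite HLtX.
rewrite -!rmorph_sum /= tofrac_eq0 mpolyC_eq0.
(* At t = 1 the sum takes the nonzero value m + 1. *)
apply/negP => /eqP /(congr1 (horner^~ 1)); rewrite horner_sum horner0.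
under eq_bigr do rewrite hornerXn expr1n.
by rewrite sumr_const card_ord => /eqP; rewrite Num.Theory.pnatr_eq0.
Qed.

Lemma HLt_neq0 : t != 0.
Proof. by rewrite tofrac_eq0 mpolyC_eq0 polyX_eq0. Qed.

Lemma HLt_neq1 : 1 - t != 0.
Proof.
rewrite -(rmorph1 (@FracField.tofrac _)) -rmorphB /= tofrac_eq0 -mpolyC1 -mpolyCB.
by rewrite mpolyC_eq0 -opprB oppr_eq0 polyXsubC_eq0.
Qed.

Lemma HLx_neq a b : b != a -> x a != t * x b.
Proof.
move=> nba; rewrite -rmorphM /= tofrac_eq; apply/negP => /eqP.
move=> /(congr1 (mcoeff U_(a))); rewrite mcoeffCM !mcoeffXU eqxx.
by rewrite (negbTE nba) mulr0 => /eqP; rewrite oner_eq0.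
Qed.

Lemma HLx_inj : injective x.
Proof.
move=> a b /eqP; rewrite tofrac_eq => /eqP /(congr1 (mcoeff U_(a))).
rewrite !mcoeffXU eqxx; case: eqVneq => // _ /eqP; rewrite oner_eq0 //.
Qed.

Lemma HL_v_sum m : HL_v N m = \prod_(i < m) \sum_(c < i.+1) t ^+ c.
Proof.
rewrite /HL_v big_add1 big_mkord; apply: eq_bigr => i _.
by rewrite -opprB subrX1 -mulNr opprB mulrAC mulfV ?mul1r // HLt_neq1.
Qed.

End Generic.

Lemma HL_mult_rr n r i :
  HL_mult n.+2 [:: r; r] i = ((r == i) + (r == i) + (i == 0) * n)%N.
Proof.
rewrite /HL_mult -sum1dep_card big_mkcond !big_ord_recl /= -addnA.
congr (_ + (_ + _))%N.
rewrite (eq_bigr (fun=> (i == 0%N) : nat)) => [|k _].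
  by rewrite sum_nat_const card_ord mulnC.
by rewrite nth_nil eq_sym.
Qed.

(** Only the part 0, of multiplicity [n], and the part [r], of multiplicity 2, contribute; the
    latter gives 1 + t, the factor that vanishes at t = -1. *)
Lemma HL_vpart_rr n r : (0 < r)%N ->
  HL_vpart n.+2 [:: r; r] =
  \prod_(m < n) (\sum_(c < m.+1) HLt n.+2 ^+ c) * (1 + HLt n.+2).
Proof.
move=> r0; rewrite /HL_vpart /= big_nat_recr //= big_ltn // big1_seq ?mulr1.
  rewrite !HL_mult_rr !eqxx (gtn_eqF r0) mul1n mul0n.
  rewrite !HL_v_sum; congr (_ * _); rewrite !big_ord_recl !big_ord0 /=.
  by rewrite !mulr1 !addr0 mul1r expr1.
move=> i; rewrite mem_index_iota => /andP[_ /andP[i0 ir]].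
by rewrite HL_mult_rr (gtn_eqF ir) (gtn_eqF i0) HL_v_sum big_ord0.
Qed.

Definition mvar (R : comNzRingType) N (i : 'I_N) : {mpoly R[N]} := 'X_i.

Lemma alternant_dvd_sum (R : comNzRingType) N (F : 'I_N -> 'I_N -> R) 
    (al : 'I_N -> 'I_N -> 'I_N -> nat) (y : 'I_N -> R) :
  exists p, alternant y (@delta N) * p =
    \sum_(c < N) \sum_(d < N | (c < d)%N) F c d * alternant y (al c d).
Proof.
pose P z := exists p, alternant y (@delta N) * p = z.
have P0 : P 0 by exists 0; rewrite mulr0.
have PD z1 z2 : P z1 -> P z2 -> P (z1 + z2).
  by move=> [p1 <-] [p2 <-]; exists (p1 + p2); rewrite mulrDr.
change (P (\sum_(c < N) \sum_(d < N | (c < d)%N) F c d * alternant y (al c d))).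
apply: big_ind => // c _; apply: big_ind => // d _.
have [S ->] := alternant_dvd y (al c d); exists (F c d * S).
by rewrite mulrCA.
Qed.

(** Dividing the alternants by the Vandermonde alternant over Z[t] produces a polynomial [p]. It is
    identified with the quotient [HL_P] in the fraction field, after multiplication by the
    normalising factor, the Vandermonde alternant and 2. *)
Lemma HL_P_rr n r : (0 < r)%N ->
  exists p : {mpoly {poly int}[n.+2]},
  p%:F = HL_P n.+2 [:: r; r] /\
  alternant (@mvar _ _) (@delta n.+2) * p =
    \sum_(c < n.+2) \sum_(d < n.+2 | (c < d)%N)
      ('X^((c + d).-1))%:MP * alternant (@mvar _ _) (add2 (@delta n.+2) r c d).
Proof.
move=> r0.
have [p hp] := alternant_dvd_sum (fun c d => ('X^((c + d).-1))%:MP)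
   (add2 (@delta n.+2) r) (@mvar {poly int} n.+2).
exists p; split => //; rewrite /HL_P /= HL_R_HLsum HL_vpart_rr //.
set v := \prod_(m < n) _ * _.
have v0 : v != 0.
  rewrite mulf_neq0 //; first by apply/prodf_neq0 => m _; apply: HLt_sum_neq0.
  by have := HLt_sum_neq0 n.+2 1; rewrite !big_ord_recl big_ord0 addr0 expr1.
apply: (mulIf v0); rewrite divfK //.
have V0 := alternant_delta_neq0 (@HLx_inj n.+2).
have tV al : (alternant (@mvar {poly int} n.+2) al)%:F = alternant (@HLx n.+2) al.
  exact: map_alternant.
apply: (mulfI V0).
have two0 : (2 : {fraction {mpoly {poly int}[n.+2]}}) != 0.
  rewrite -(rmorph_nat (@FracField.tofrac _)) tofrac_eq0 -(rmorph_nat (@mpolyC n.+2 _)).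
  by rewrite mpolyC_eq0 -polyC_natr polyC_eq0.
apply: (mulIf two0); rewrite !mulr_natr HLsum_rr ?HLt_neq0 //; first last.
- by move=> a b nba; apply: HLx_neq.
- exact: HLx_inj.
rewrite sum_neq_sym => [|c d]; last first.
  by rewrite addnC (eq_alternant (fun=> erefl) (add2C _ _ _ _)).
rewrite -tV mulrA -rmorphM /= hp mulrC -mulrnAr; congr (_ * (_ *+ 2)).
rewrite !rmorph_sum; apply: eq_bigr => c _; rewrite rmorph_sum; apply: eq_bigr => d _.
by rewrite rmorphM /= tV HLtX.
Qed.

(** The generic identity has no denominators left, so the evaluation of coefficients at t = -1, a
    ring morphism, applies to both sides. *)
Lemma HL_P_at_rr n r : (0 < r)%N ->
  exists2 q : {mpoly int[n.+2]}, HL_P_at [:: r; r] (-1) q &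
  alternant (@mvar _ _) (@delta n.+2) * q =
    \sum_(c < n.+2) \sum_(d < n.+2 | (c < d)%N)
      (-1) ^+ (c + d).-1 * alternant (@mvar _ _) (add2 (@delta n.+2) r c d).
Proof.
move=> r0; have [p [hp ep]] := HL_P_rr n r0.
have mV al : map_mpoly (horner_eval (-1 : int)) (alternant (@mvar {poly int} n.+2) al)
    = alternant (@mvar int n.+2) al.
  by rewrite map_alternant; apply: eq_alternant => // i; rewrite /= map_mpolyX.
exists (map_mpoly (horner_eval (-1)) p); first by exists p.
rewrite -mV -rmorphM /= ep rmorph_sum; apply: eq_bigr => c _.
rewrite rmorph_sum; apply: eq_bigr => d _.
rewrite rmorphM /= mV map_mpolyC; congr (_ * _).
by rewrite /= horner_evalE hornerXn rmorphXn rmorphN1.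
Qed.

Definition part_exp (la : seq nat) N (j : 'I_N) : nat := (nth 0 la j + delta j)%N.

Arguments part_exp la {N} j.

(** * Specialization at t = -1 *)

(* The partitions reached by straightening delta + r e_c + r e_d: hook r d when
   d = c + r, and tworow r c d when c < d < r. *)
Definition hook r d := (2 * r - d)%N :: nseq d 1%N.
Definition tworow r c d :=
  [:: (r - c)%N, (r - d).+1 & nseq c 2%N ++ nseq (d - c.+1) 1%N].

Section Straightening.

Variables (R : comNzRingType) (n r : nat) (y : 'I_n.+2 -> R).
Hypothesis r0 : (0 < r)%N.
Local Notation al := (add2 (@delta n.+2) r).

(** Columns [c] and [d] move to the front. Columns before [c] shift by two places and give the parts
    2, those between [c] and [d] shift by one and give the parts 1. *)
Lemma alternant_tworow (c d : 'I_n.+2) : (c < d)%N -> (d < r)%N ->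
  alternant y (al c d) = (-1) ^+ (c + d).-1 * alternant y (part_exp (tworow r c d)).
Proof.
move=> cd dr.
(* [d'] is the position of [d] once [c] is removed, namely d - 1; hence the sign (-1)^(c+d-1). *)
have [d' ed] : {d' : 'I_n.+1 | d = lift c d'}.
  by case: (unliftP c d) cd => [d' -> _|->]; [exists d' | rewrite ltnn].
have cd' : (c <= d')%N by move: cd; rewrite ed /= /bump; lia.
have vd : d = d'.+1 :> nat by rewrite ed /= /bump cd'.
rewrite (alternant_permr _ _ (lift_perm ord0 c (lift_perm ord0 d' 1%g))).
congr (_ * _).
  rewrite !odd_lift_perm odd_perm1 /= addbF vd addnS /= -[RHS]signr_odd oddD.
  by case: (odd c); case: (odd d').
apply: eq_alternant => // i /=.
case: (unliftP ord0 i) => /= [i'|]; last first.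
  move=> ->; rewrite lift_perm_id /add2 eqxx /part_exp /delta /=.
  have := ltn_ord c; rewrite -val_eqE /=; lia.
move=> ->; rewrite lift_perm_lift.
case: (unliftP ord0 i') => /= [k|]; last first.
  move=> ->; rewrite lift_perm_id -ed /add2 eqxx /part_exp /delta /=.
  have := ltn_ord d; rewrite -val_eqE /= /bump /=; lia.
move=> ->; rewrite lift_perm_lift perm1 /add2 /part_exp /delta.
have /negbTE-> : lift c (lift d' k) != c by rewrite eq_sym neq_lift.
have /negbTE-> : lift c (lift d' k) != d by rewrite ed (inj_eq lift_inj) eq_sym neq_lift.
rewrite !mul0n !addn0 /= !nth_cat !size_nseq !nth_nseq /bump /= vd.
have := (ltn_ord k, ltn_ord d') => -[kn dn].
by case: (ltnP k c) => ?; case: (ltnP k d') => ?; try case: ltnP => ?; lia.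
Qed.

(** Column [d] now has the exponent that column [c] had in [delta]. Exchanging the two and moving
    the raised column from place [d] to the front sorts the exponents, with sign -(-1)^d. *)
Lemma alternant_hook (c d : 'I_n.+2) : (c < r)%N -> d = (c + r)%N :> nat ->
  alternant y (al c d) = - (-1) ^+ d * alternant y (part_exp (hook r d)).
Proof.
move=> cr ed; have cd : c != d by rewrite -val_eqE /= ed; lia.
rewrite (alternant_permr _ _ (lift_perm ord0 d 1 * tperm c d)%g); congr (_ * _).
  rewrite odd_permM odd_tperm cd odd_lift_perm odd_perm1 /= addbF addbT.
  by rewrite signrN signr_odd.
apply: eq_alternant => // i /=; rewrite permM.
case: (unliftP ord0 i) => /= [k|]; last first.
  move=> ->; rewrite lift_perm_id tpermR /add2 eqxx (negbTE cd) /part_exp /delta /=.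
  have := ltn_ord c; have := ltn_ord d; lia.
move=> ->; rewrite lift_perm_lift perm1 /part_exp /hook /= nth_nseq.
have := (ltn_ord k, ltn_ord d) => -[kn dn]; rewrite /add2 /delta.
case: tpermP => [/(congr1 val)|/(congr1 val)|]; rewrite -?val_eqE /= /bump.
- by case: ltnP => ?; lia.
- by lia.
move=> /eqP /negbTE + /eqP /negbTE.
rewrite -!val_eqE /= /bump => -> ->; rewrite !addn0.
by case: ltnP => ?; lia.
Qed.

(** Raising column [d >= r] by [r] gives it the exponent of column [d - r] in [delta]. Unless
    [d - r = c] the two collide; if [d - r = c] and [c >= r], column [c] collides with column
    [c - r]. *)
Lemma alternant_straighten (c d : 'I_n.+2) : (c < d)%N ->
  (-1) ^+ (c + d).-1 * alternant y (al c d) =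
  (if (d < r)%N then alternant y (part_exp (tworow r c d)) else 0) +
  (if (c < r)%N && (d == c + r :> nat)%N
   then (-1) ^+ c * alternant y (part_exp (hook r d)) else 0).
Proof.
move=> cd; case: ltnP => [dr|rd].
  rewrite alternant_tworow // mulrA -expr2 sqrr_sign mul1r.
  by rewrite (_ : (d == c + r :> nat)%N = false) ?andbF ?addr0 //; lia.
rewrite add0r; have [ed|ned] := eqVneq (d : nat) (c + r)%N.
  have [cr|rc] := ltnP c r => /=.
    rewrite alternant_hook // mulrA; congr (_ * _).
    have -> : (c + d).-1 = (c + c + r.-1)%N by lia.
    rewrite ed mulrN -exprD -[LHS]mulN1r -exprS.
    by rewrite -signr_odd -[RHS]signr_odd; congr (_ ^+ _); lia.
  have h : (c - r < n.+2)%N by have := ltn_ord c; lia.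
  rewrite (@alternant_collision _ _ _ _ c (Ordinal h)) ?mulr0 //.
    by rewrite -val_eqE /=; lia.
  by rewrite /add2 /delta -!val_eqE /=; have := ltn_ord c; lia.
rewrite andbF.
have h : (d - r < n.+2)%N by have := ltn_ord d; lia.
rewrite (@alternant_collision _ _ _ _ d (Ordinal h)) ?mulr0 //.
  by rewrite -val_eqE /=; lia.
by rewrite /add2 /delta -!val_eqE /=; have := ltn_ord d; lia.
Qed.

End Straightening.

(** * The explicit Schur expansion of P_(r,r) at t = -1 *)

Lemma schurE N la : (size la <= N)%N ->
  schur N la = (alternant (@mvar int N) (part_exp la))%:F /
               (alternant (@mvar int N) (@delta N))%:F.
Proof.
move=> h; rewrite /schur h.
have e al : (alternant (@mvar int N) al)%:F = alternant (@schur_x N) al.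
  exact: map_alternant.
by congr (_ / _); apply: esym; apply: e.
Qed.

Lemma mvar_inj (R : comNzRingType) N : injective (@mvar R N).
Proof.
move=> a b /(congr1 (mcoeff U_(a))); rewrite !mcoeffXU eqxx.
by case: eqVneq => // _ /eqP; rewrite oner_eq0.
Qed.

Lemma alternant_mvar_neq0 N : 
  (alternant (@mvar int N) (@delta N))%:F != 0.
Proof.
rewrite map_alternant; apply: alternant_delta_neq0 => a b /= /eqP.
by rewrite tofrac_eq => /eqP /mvar_inj.
Qed.

Definition rr_terms r : seq (seq nat * int) :=
  [seq (tworow r c d, 1) | d <- iota 0 r, c <- iota 0 d] ++
  [seq (hook r (c + r), (-1) ^+ c) | c <- iota 0 r].

(** Occurrences of the same partition are added up, so [rr_terms] can list the terms just as
    straightening produces them. *)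
Definition rr_coef r (la : seq nat) : int :=
  \sum_(p <- rr_terms r | p.1 == la) p.2.

Definition rr_fsfun r : {fsfun seq nat -> int with 0} :=
  [fsfun la in [fset p.1 | p in rr_terms r]%fset => rr_coef r la].

Lemma rr_fsfunE r la : rr_fsfun r la = rr_coef r la.
Proof.
rewrite fsfun_fun; case: ifPn => // h; rewrite /rr_coef big_seq_cond big1 //.
move=> p /andP[pL /eqP e]; case/negP: h; apply/imfsetP; exists p => //.
Qed.

(** Both sums equal the one over the distinct keys [U] of [L]; keys outside the support have
    coefficient zero. *)
Lemma finsupp_sum (T : choiceType) (A : zmodType) (L : seq (T * int))
    (c : {fsfun T -> int with 0}) (S : T -> A) :
  (forall la, c la = \sum_(p <- L | p.1 == la) p.2) ->
  \sum_(la <- finsupp c) S la *~ c la = \sum_(p <- L) S p.1 *~ p.2.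
Proof.
move=> hc; pose U := undup (map fst L).
transitivity (\sum_(la <- U) S la *~ c la).
  rewrite [RHS](bigID (fun la => c la == 0)) /= [X in _ = X + _]big1 ?add0r; last first.
    by move=> la /eqP ->; rewrite mulr0z.
  rewrite -[RHS]big_filter; apply: perm_big; apply: uniq_perm.
  - exact: fset_uniq.
  - by rewrite filter_uniq ?undup_uniq.
  move=> la; rewrite mem_filter mem_finsupp mem_undup.
  case: (eqVneq (c la) 0) => //= h; apply/esym; apply: contraNT h => h; apply/eqP.
  rewrite hc big_seq_cond big1 // => p /andP[pL /eqP e].
  by case/negP: h; rewrite -e map_f.
under eq_bigr do rewrite hc mulrz_sumr.
rewrite (exchange_big_dep xpredT) //= big_seq [RHS]big_seq.
apply: eq_bigr => p pL; rewrite -big_filter.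
rewrite (_ : filter _ _ = [:: p.1]) ?big_seq1 //.
have : p.1 \in U by rewrite mem_undup map_f.
rewrite (eq_filter (a2 := pred1 p.1)) => [pU|la]; last by rewrite /= eq_sym.
by rewrite filter_pred1_uniq ?undup_uniq.
Qed.

Lemma path_geq_nseq x v k s : (v <= x)%N ->
  path geq v s -> path geq x s -> path geq x (nseq k v ++ s).
Proof. by elim: k x => //= k IH x vx vs xs; rewrite vx IH. Qed.

Lemma rr_terms_part r p : p \in rr_terms r -> is_part p.1.
Proof.
rewrite mem_cat => /orP[/allpairsPdep[d [c [hd hc ->]]]|/mapP[c hc ->]] /=.
  move: hd hc; rewrite !mem_iota /= !add0n => dr cd.
  rewrite /is_part /= !inE mem_cat !mem_nseq /= !andbF !orbF.
  have -> : path geq (r - d).+1 (nseq c 2%N ++ nseq (d - c.+1) 1%N).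
    by rewrite -[X in _ ++ X]cats0 !path_geq_nseq //; lia.
  by rewrite andbT; lia.
move: hc; rewrite mem_iota /= add0n => cr.
rewrite /is_part /hook /= inE mem_nseq andbF orbF.
rewrite -[X in path _ _ X]cats0 path_geq_nseq //; lia.
Qed.

Lemma rr_terms_size r p : p \in rr_terms r -> (1 < size p.1)%N.
Proof.
rewrite mem_cat => /orP[/allpairsPdep[d [c [hd hc ->]]]|/mapP[c hc ->]] //=.
by move: hc; rewrite mem_iota size_nseq; lia.
Qed.

Lemma schur_large N la : (N < size la)%N -> schur N la = 0.
Proof. by move=> h; rewrite /schur leqNgt h. Qed.

Lemma sum_rr_terms (A : zmodType) (S : seq nat -> A) r :
  \sum_(p <- rr_terms r) S p.1 *~ p.2 =
  \sum_(0 <= d < r) \sum_(0 <= c < d) S (tworow r c d) +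
  \sum_(0 <= c < r) S (hook r (c + r)) *~ (-1) ^+ c.
Proof.
rewrite big_cat big_allpairs_dep big_map /= /index_iota !subn0; congr (_ + _).
by apply: eq_bigr => d _; rewrite subn0; apply: eq_bigr => c _; rewrite mulr1z.
Qed.

(** The two sides differ only in their ranges. A term of [rr_terms] with [d >= N] is a partition
    with d + 1 > N parts, whose Schur polynomial vanishes. *)
Lemma schur_sum_straighten N r (A := {fraction {mpoly int[N]}}) :
  \sum_(c < N) \sum_(d < N | (c < d)%N)
    ((if (d < r)%N then schur N (tworow r c d) else 0) +
     (if (c < r)%N && (d == c + r :> nat)%N
      then schur N (hook r d) *~ (-1) ^+ c else 0)) =
  \sum_(p <- rr_terms r) schur N p.1 *~ p.2.
Proof.
rewrite sum_rr_terms.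
under eq_bigr do rewrite big_split /=.
rewrite big_split /=; congr (_ + _).
  rewrite (exchange_big_dep xpredT) //= big_mkord.
  pose M := (N + r)%N.
  rewrite (big_ord_widen M (fun d => \sum_(c < N | (c < d)%N)
     if (d < r)%N then schur N (tworow r c d) else 0)) ?leq_addr //.
  rewrite (big_ord_widen M (fun d => \sum_(0 <= c < d) schur N (tworow r c d)))
    ?leq_addl //.
  rewrite big_mkcond [RHS]big_mkcond /=; apply: eq_bigr => d _.
  rewrite big_mkord; case: (ltnP d r) => dr; case: (ltnP d N) => dN //.
  - rewrite (big_ord_widen N (fun c => schur N (tworow r c d))) //; exact: ltnW.
  - rewrite big1 // => c _; rewrite schur_large //=.
    by rewrite size_cat !size_nseq; have := ltn_ord c; lia.
  - by rewrite big1.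
pose M := (N + r)%N.
rewrite big_mkord.
rewrite (big_ord_widen M (fun c => \sum_(d < N | (c < d)%N)
   if (c < r)%N && (d == c + r :> nat)%N then schur N (hook r d) *~ (-1) ^+ c else 0))
   ?leq_addr //.
rewrite (big_ord_widen M (fun c => schur N (hook r (c + r)) *~ (-1) ^+ c)) ?leq_addl //.
rewrite big_mkcond [RHS]big_mkcond /=; apply: eq_bigr => c _.
case: (ltnP c r) => cr; last by case: ifP => // _; rewrite big1.
have r0 : (0 < r)%N by case: (r) cr.
case: (ltnP (c + r) N) => crN.
  rewrite (leq_ltn_trans (leq_addr r c) crN) (bigD1 (Ordinal crN)) /=; last by lia.
  rewrite eqxx big1 ?addr0 // => d /andP[_]; rewrite -val_eqE /=.
  by move/negbTE->.
rewrite schur_large /= ?size_nseq ?mul0rz; last by lia.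
case: ifP => // _; rewrite big1 // => d _; case: eqP => // e.
by have := ltn_ord d; lia.
Qed.

Lemma is_schur_expansion_rr r : (0 < r)%N ->
  is_schur_expansion [:: r; r] (rr_fsfun r).
Proof.
move=> r0; split=> [la|N].
  rewrite mem_finsupp rr_fsfunE => h.
  have [/hasP[p pL /eqP <-]|/hasPn hn] := boolP (has (fun p => p.1 == la) (rr_terms r)).
    exact: rr_terms_part pL.
  case/negP: h; rewrite /rr_coef big_seq_cond big1 // => p /andP[pL].
  by rewrite (negbTE (hn _ pL)).
have hsum := finsupp_sum (schur N) (rr_fsfunE r).
case: N hsum => [|[|n]] hsum.
(* With fewer than two variables both sides are zero, since (r,r) and all partitions of [rr_terms]
   have at least two parts. *)
- exists 0; first by exists 0; rewrite ?rmorph0.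
  rewrite hsum rmorph0 big_seq big1 // => p pL.
  by rewrite schur_large ?mul0rz // ltnW // (rr_terms_size pL).
- exists 0; first by exists 0; rewrite ?rmorph0.
  rewrite hsum rmorph0 big_seq big1 // => p pL.
  by rewrite schur_large ?mul0rz // (rr_terms_size pL).
have [q hq eq] := HL_P_at_rr n r0; exists q => //.
rewrite hsum -schur_sum_straighten.
have V0 := alternant_mvar_neq0 n.+2.
apply: (mulfI V0); rewrite -rmorphM eq rmorph_sum mulr_sumr.
apply: eq_bigr => c _; rewrite rmorph_sum mulr_sumr; apply: eq_bigr => d cd.
rewrite alternant_straighten // rmorphD mulrDr; congr (_ + _).
  case: ifP => dr; last by rewrite rmorph0 mulr0.
  rewrite schurE; first by rewrite [RHS]mulrC divfK.
  by rewrite /= size_cat !size_nseq; have := ltn_ord d; lia.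
case: ifP => [/andP[cr /eqP ed]|_]; last by rewrite rmorph0 mulr0.
rewrite schurE; last by rewrite /= size_nseq.
rewrite -mulrzr !rmorphXn !rmorphN1 rmorphM rmorphXn rmorphN1.
by rewrite mulrA [_ * (_ / _)]mulrC divfK // mulrC.
Qed.

(** * Uniqueness of the Schur expansion *)

Lemma part_nth_geq la i j : is_part la -> (i <= j)%N -> (nth 0 la j <= nth 0 la i)%N.
Proof.
move=> /andP[sla _] ij; case: (ltnP j (size la)) => [jla|lj]; last by rewrite nth_default.
have geq_trans : transitive geq by move=> b a c /= ab bc; apply: leq_trans bc ab.
have ila := leq_ltn_trans ij jla.
by apply: (sorted_leq_nth geq_trans leqnn 0 sla).
Qed.

Lemma part_nth_gt0 la i : is_part la -> (0 < nth 0 la i)%N = (i < size la)%N.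
Proof.
move=> /andP[_ nla]; case: (ltnP i (size la)) => [ila|lai]; last by rewrite nth_default.
by rewrite lt0n; apply: contraNneq nla => <-; rewrite mem_nth.
Qed.

Lemma part_inj la mu : is_part la -> is_part mu -> nth 0%N la =1 nth 0%N mu -> la = mu.
Proof.
move=> pla pmu e; apply: (@eq_from_nth _ 0%N) => //.
have h i : (i < size la)%N = (i < size mu)%N by rewrite -!part_nth_gt0 // e.
by apply/eqP; rewrite eqn_leq andbC leqNgt -h ltnn leqNgt h ltnn.
Qed.

Lemma part_exp_lt la N (i j : 'I_N) : is_part la -> (i < j)%N ->
  (part_exp la j < part_exp la i)%N.
Proof.
move=> pla ij; have := part_nth_geq pla (ltnW ij).
by rewrite /part_exp /delta; have := ltn_ord j; lia.
Qed.

(** An increasing map satisfies m <= w m; the inverse permutation is increasing too, which gives the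
    reverse inequality. *)
Lemma perm_incr_id N (w : 'S_N) : (forall i j : 'I_N, (i < j)%N -> (w i < w j)%N) -> w = 1%g.
Proof.
have ge_id (v : 'S_N) : (forall i j : 'I_N, (i < j)%N -> (v i < v j)%N) ->
    forall m (hm : (m < N)%N), (m <= v (Ordinal hm))%N.
  move=> hv; elim=> // m IH hm; apply: leq_ltn_trans (IH (ltnW hm)) _.
  exact: hv.
move=> hw; apply/permP => i; rewrite perm1; apply/val_inj/eqP.
rewrite eqn_leq; apply/andP; split; last first.
  by have := ge_id _ hw i (ltn_ord i); rewrite (_ : Ordinal _ = i) //; apply: val_inj.
have hw' (a b : 'I_N) : (a < b)%N -> ((w^-1)%g a < (w^-1)%g b)%N.
  move=> ab; rewrite ltnNge leq_eqVlt negb_or; apply/andP; split.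
    by apply/negP => /eqP /val_inj /perm_inj e; rewrite e ltnn in ab.
  by apply/negP => /hw; rewrite !permKV ltnNge ltnW.
have := ge_id _ hw' (w i) (ltn_ord _).
by rewrite (_ : Ordinal _ = w i) ?permK //; apply: val_inj.
Qed.

(** The exponents la + delta and mu + delta are strictly decreasing, so only the identity
    permutation can match them in the Leibniz expansion, and then la = mu. *)
Lemma coef_alternant N la mu : is_part la -> is_part mu ->
  (size la <= N)%N -> (size mu <= N)%N ->
  (alternant (@mvar int N) (part_exp la))@_[multinom part_exp mu i | i < N] =
    (la == mu)%:R.
Proof.
move=> pla pmu sla smu; rewrite alternantE raddf_sum /=.
have cw (w : 'S_N) : ((-1) ^+ w * \prod_i @mvar int N i ^+ part_exp la (w i))
      @_[multinom part_exp mu i | i < N] =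
    (-1) ^+ w * ([multinom part_exp la (w i) | i < N] ==
                 [multinom part_exp mu i | i < N])%:R.
  rewrite -(rmorph_sign (@mpolyC N int)) mcoeffCM -mcoeffX mpolyXE_id.
  by congr (_ * _@__); apply: eq_bigr => i _; rewrite mnmE.
under eq_bigr do rewrite cw.
have key (w : 'S_N) : [multinom part_exp la (w i) | i < N] ==
    [multinom part_exp mu i | i < N] -> w = 1%g /\ la = mu.
  move=> /eqP e; have ew i : part_exp la (w i) = part_exp mu i.
    by have := congr1 (fun m : 'X_{1..N} => m i) e; rewrite !mnmE.
  have w1 : w = 1%g.
    apply: perm_incr_id => i j ij; rewrite ltnNge leq_eqVlt negb_or.
    have lt := part_exp_lt pmu ij.
    apply/andP; split; apply/negP.
      by move=> /eqP /val_inj /perm_inj e'; rewrite e' ltnn in ij.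
    by move=> /(part_exp_lt pla); rewrite !ew ltnNge ltnW.
  split=> //; apply: part_inj => // i; case: (ltnP i N) => [iN|Ni].
    by have := ew (Ordinal iN); rewrite w1 perm1 /part_exp => /addIn.
  by rewrite !nth_default ?(leq_trans _ Ni).
case: eqVneq => [elm|ne].
  rewrite (bigD1 1%g) //= big1 ?addr0 => [|w nw]; last first.
    by case: (boolP (_ == _)) => [/key [e _]|_]; [rewrite e eqxx in nw | rewrite mulr0].
  rewrite odd_perm1 mul1r; case: eqP => // -[].
  by apply/mnmP => i; rewrite !mnmE perm1 elm.
rewrite big1 // => w _; case: (boolP (_ == _)) => [/key [_ e]|_]; last by rewrite mulr0.
by rewrite e eqxx in ne.
Qed.

Lemma expansion_coef N (q : {mpoly int[N]}) (c : {fsfun seq nat -> int with 0}) la :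
  (forall mu, mu \in finsupp c -> is_part mu) ->
  (forall mu, mu \in finsupp c -> (size mu <= N)%N) ->
  q%:F = \sum_(mu <- finsupp c) schur N mu *~ c mu ->
  is_part la -> (size la <= N)%N ->
  c la = (alternant (@mvar int N) (@delta N) * q)@_[multinom part_exp la i | i < N].
Proof.
move=> cp cs hq pla sla.
have V0 := alternant_mvar_neq0 N.
have -> : alternant (@mvar int N) (@delta N) * q =
    \sum_(mu <- finsupp c) alternant (@mvar int N) (part_exp mu) *~ c mu.
  apply/eqP; rewrite -tofrac_eq rmorphM /= hq; apply/eqP; rewrite mulr_sumr [RHS]rmorph_sum.
  rewrite big_seq [RHS]big_seq; apply: eq_bigr => mu hmu.
  by rewrite rmorphMz schurE ?cs // mulrzAr [_ * (_ / _)]mulrC divfK.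
rewrite raddf_sum /= big_seq.
rewrite (eq_bigr (fun mu => (mu == la)%:R *~ c mu)); last first.
  by move=> mu hmu; rewrite raddfMz /= (coef_alternant (cp _ hmu) pla (cs _ hmu) sla).
rewrite -big_seq; case: (boolP (la \in finsupp c)) => [h|h].
  rewrite (bigD1_seq la) ?fset_uniq //= eqxx intz big1 ?addr0 //.
  by move=> mu /negbTE ->; rewrite mul0rz.
rewrite fsfun_dflt // big_seq big1 // => mu hmu.
by rewrite (negbTE (memPn h _ hmu)) mul0rz.
Qed.

Lemma schur_expansion_uniq mu c1 c2 :
  is_schur_expansion mu c1 -> is_schur_expansion mu c2 -> c1 =1 c2.
Proof.
move=> [p1 e1] [p2 e2] la.
case: (boolP (is_part la)) => [pla|npla]; last first.
  by rewrite !fsfun_dflt //; [apply: contra (p2 la) npla | apply: contra (p1 la) npla].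
(* Enough variables for [la] and both supports, so that none of these Schur polynomials is replaced
   by zero. *)
pose N := (\max_(nu <- la :: finsupp c1 ++ finsupp c2) size nu)%N.
have sN nu : nu \in la :: finsupp c1 ++ finsupp c2 -> (size nu <= N)%N.
  by move=> h; exact: (leq_bigmax_seq (P := xpredT) _ h).
have [q1 [r1 er1 eq1] s1] := e1 N; have [q2 [r2 er2 eq2] s2] := e2 N.
have eq12 : q1 = q2.
  by rewrite eq1 eq2; congr (map_mpoly _ _); apply/eqP; rewrite -tofrac_eq er1 er2.
have sla : (size la <= N)%N by apply: sN; rewrite inE eqxx.
have b1 nu : nu \in finsupp c1 -> (size nu <= N)%N.
  by move=> h; apply: sN; rewrite inE mem_cat h orbT.
have b2 nu : nu \in finsupp c2 -> (size nu <= N)%N.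
  by move=> h; apply: sN; rewrite inE mem_cat h !orbT.
by rewrite (expansion_coef p1 b1 s1 pla sla) (expansion_coef p2 b2 s2 pla sla) eq12.
Qed.

Lemma rr_coef_hook r j : (j < 2 * r)%N ->
  rr_coef r (hook r j) = if (j < r)%N then 0 else (-1) ^+ (r + j).
Proof.
(* No [tworow] term is a hook: its second part is r - d + 1 >= 2, because d < r. *)
move=> j2r; rewrite /rr_coef big_cat /= [X in X + _]big_seq_cond big1 ?add0r; last first.
  move=> p /andP[/allpairsPdep[d [c [hd hc ->]]]] /= /eqP[_].
  move: hd; rewrite mem_iota; case: (j) => // k dr [e _]; lia.
rewrite big_map.
(* Hooks are told apart by their length, so only c = j - r can contribute. *)
have -> : \sum_(c <- iota 0 r | hook r (c + r) == hook r j) (-1) ^+ c =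
    \sum_(c <- iota 0 r | (c + r == j)%N) (-1) ^+ c :> int.
  apply: eq_bigl => c; apply/eqP/eqP => [/(congr1 size)|-> //].
  by rewrite /= !size_nseq => -[].
case: ltnP => [jr|rj]; first by rewrite big1 // => c /eqP; lia.
rewrite -big_filter (_ : filter _ _ = [:: j - r]%N) ?big_seq1.
  by rewrite -signr_odd -[RHS]signr_odd; congr (_ ^+ _); lia.
rewrite (eq_filter (a2 := pred1 (j - r)%N)) => [|c /=]; last by lia.
by rewrite filter_pred1_uniq ?iota_uniq // mem_iota; lia.
Qed.

Theorem theorem4p7 (r n j : nat) (hr : (1 <= r)%N) (hn : n = (2 * r)%N)
    (hj : (0 <= j <= n - 1)%N) :
  g [:: r; r] ((n - j)%N :: nseq j 1%N) =
    if (j < r)%N then 0 else (-1) ^+ (r + j).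
Proof.
rewrite -rr_coef_hook; last by lia.
(* The expansion picked by [epsilon] is unknown but, as one exists, satisfies the specification;
   uniqueness identifies it with [rr_fsfun r]. *)
rewrite hn -rr_fsfunE /g; apply: (schur_expansion_uniq _ (is_schur_expansion_rr hr)).
by apply: epsilon_spec; exists (rr_fsfun r); apply: is_schur_expansion_rr.
Qed.
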